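(* For every positive equivalence relation $\eta$, there is an $\eta$-family contained in the ascending family $\{A_n:n\in\mathbb N\}$ that is neither class-preservingly conservatively behaviourally correctly learnable nor class-preservingly strongly monotonically behaviourally correctly learnable.
   Context: A positive equivalence relation is an equivalence relation $\eta$ on $\mathbb{N}$ that is recursively enumerable (as a set of pairs) and has infinitely many equivalence classes. For $x\in\mathbb N$ let $[x]=\{y:y\,\eta\,x\}$. Let $a_0<a_1<\cdots$ be the least elements of the $\eta$-equivalence classes in increasing order and $A_n=\bigcup_{m<n}[a_m]$. A set is $\eta$-closed if it is a union of $\eta$-classes. An $\eta$-family is an infinite family of $\eta$-closed sets possessing a uniformly r.e. one-one numbering $B_0,B_1,\dots$ (i.e. $\{\langle k,x\rangle:x\in B_k\}$ is r.e. and $B_i\neq B_j$ for $i\ne j$). A text for $L$ is a total $T:\mathbb N\to\mathbb N\cup\{\#\}$ whose range minus $\{\#\}$ is $L$; $T[n]$ is its initial segment of length $n$ and $\mathrm{cnt}(\sigma)$ the set of numbers in $\sigma$. A learner is a recursive function $M$ from finite sequences over $\mathbb N\cup\{\#\}$ to $\mathbb N\cup\{?\}$. Class-preserving learning of $\mathcal C$ means: there is a uniformly r.e. hypothesis space $H_0,H_1,\dots$ with $\{H_i:i\in\mathbb N\}=\mathcal C$, output $i$ being interpreted as $H_i$, and: $M$ behaviourally correctly learns $\mathcal C$ if on every text $T$ for every $L\in\mathcal C$, $H_{M(T[n])}=L$ for almost all $n$; it does so conservatively if moreover for all texts $T$, all $n$ and $k\ge1$, $H_{M(T[n])}\ne H_{M(T[n+k])}$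 only if $\mathrm{cnt}(T[n+k])\not\subseteq H_{M(T[n])}$; it does so strongly monotonically if moreover for all texts $T$, all $n$ and $k\ge 1$, $H_{M(T[n])}\subseteq H_{M(T[n+k])}$. *)

(* Defs.v *)
From Corelib Require Import RelationClasses.
From Stdlib Require Cantor.
From mathcomp Require Import all_boot.
From mathcomp Require Import boolp classical_sets functions cardinality.

Set Implicit Arguments.
Unset Strict Implicit.
Unset Printing Implicit Defensive.

Local Open Scope classical_set_scope.

(** * Recursive functions and r.e. sets of natural numbers *)

Definition cpair (x y : nat) : nat := Cantor.to_nat (x, y).
Definition cfst (p : nat) : nat := (Cantor.of_nat p).1.
Definition csnd (p : nat) : nat := (Cantor.of_nat p).2.

(** Unary partial recursive functions. Several arguments are passed through the
    bijection [cpair], so the identity is [Pairing Fst Snd] and the constructors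
    below generate exactly the usual mu-recursive functions. *)
Inductive code : Type :=
  | Zero | Succ | Fst | Snd
  | Pairing (f g : code)
  | Comp (f g : code)
  | Prec (f g : code)
  | Mini (f : code).

Fixpoint prec_graph (F G : nat -> nat -> Prop) (a n y : nat) : Prop :=
  match n with
  | 0 => F a y
  | n'.+1 => exists2 u, prec_graph F G a n' u & G (cpair a (cpair n' u)) y
  end.

(** [computes c x y]: the partial function coded by [c] is defined at [x], with
    value [y]. [Prec f g] at <a, n> satisfies h(a, 0) = f(a) and
    h(a, n+1) = g(a, n, h(a, n)); [Mini f] at [x] is the least [y] such that
    f(x, y) = 0 and f(x, z) is defined for all z < y. *)
Fixpoint computes (c : code) (x y : nat) : Prop :=
  match c with
  | Zero => y = 0
  | Succ => y = x.+1
  | Fst => y = cfst x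
  | Snd => y = csnd x
  | Pairing f g => exists u v, [/\ computes f x u, computes g x v & y = cpair u v]
  | Comp f g => exists2 u, computes g x u & computes f u y
  | Prec f g => prec_graph (computes f) (computes g) (cfst x) (csnd x) y
  | Mini f => computes f (cpair x y) 0 /\
              forall z, z < y -> exists v, computes f (cpair x z) v.+1
  end.

Definition re (A : set nat) : Prop :=
  exists c, A = [set x | exists y, computes c x y].

Definition re_rel (R : nat -> nat -> Prop) : Prop :=
  re [set p | R (cfst p) (csnd p)].

Definition uniformly_re (B : nat -> set nat) : Prop :=
  re_rel (fun k x => B k x).

(** * Positive equivalence relations *)

Definition eclass (eta : nat -> nat -> Prop) (x : nat) : set nat :=
  [set y | eta y x].

Definition positive_equivalence (eta : nat -> nat -> Prop) : Prop :=
  [/\ Equivalence eta, re_rel eta & infinite_set (range (eclass eta))].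

(** [a] lists the least elements of the [eta]-classes in increasing order. *)
Definition least_reps (eta : nat -> nat -> Prop) (a : nat -> nat) : Prop :=
  {homo a : m n / m < n} /\
  range a = [set x | forall y, eclass eta x y -> x <= y].

Definition A_ (eta : nat -> nat -> Prop) (a : nat -> nat) (n : nat) : set nat :=
  \bigcup_(m in [set m | m < n]) eclass eta (a m).

Definition eta_closed (eta : nat -> nat -> Prop) (L : set nat) : Prop :=
  exists D : set nat, L = \bigcup_(x in D) eclass eta x.

Definition eta_family (eta : nat -> nat -> Prop) (C : set (set nat)) : Prop :=
  [/\ infinite_set C,
      forall L, C L -> eta_closed eta L &
      exists B : nat -> set nat,
        [/\ uniformly_re B, injective B & range B = C]].

(** * Texts and learners *)

(** A text symbol is [Some x], or [None] for the pause symbol #. *)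
Definition text := nat -> option nat.

Definition prefix_of (T : text) (n : nat) : seq (option nat) := mkseq T n.

Definition cnt (s : seq (option nat)) : set nat := [set x | Some x \in s].

Definition text_for (T : text) (L : set nat) : Prop :=
  [set x | exists n, T n = Some x] = L.

(** A learner outputs [Some i], conjecturing hypothesis [i], or [None], i.e. the
    symbol ?, which makes no conjecture. *)
Definition learner := seq (option nat) -> option nat.

Definition encode_symbol (o : option nat) : nat :=
  if o is Some x then x.+1 else 0.

Definition encode_seq (s : seq (option nat)) : nat :=
  foldr (fun o n => (cpair (encode_symbol o) n).+1) 0 s.

Definition recursive_learner (M : learner) : Prop :=
  exists c, forall s, computes c (encode_seq s) (encode_symbol (M s)).

Section Learning.
Variables (H : nat -> set nat) (M : learner).

Definition BC_learns (C : set (set nat)) : Prop :=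
  forall L, C L -> forall T, text_for T L ->
  exists n0, forall n, n0 <= n ->
  exists2 i, M (prefix_of T n) = Some i & H i = L.

(** In the next two conditions only genuine conjectures are compared: they say
    nothing about prefixes on which the output is ?. *)
Definition conservative : Prop :=
  forall (T : text) (n k i j : nat), 1 <= k ->
  M (prefix_of T n) = Some i -> M (prefix_of T (n + k)) = Some j ->
  H i <> H j -> ~ (cnt (prefix_of T (n + k)) `<=` H i).

Definition strongly_monotone : Prop :=
  forall (T : text) (n k i j : nat), 1 <= k ->
  M (prefix_of T n) = Some i -> M (prefix_of T (n + k)) = Some j ->
  H i `<=` H j.

End Learning.

Definition class_preserving (H : nat -> set nat) (C : set (set nat)) : Prop :=
  uniformly_re H /\ range H = C.

Definition ConsvBC_learnable (C : set (set nat)) : Prop :=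
  exists (H : nat -> set nat) (M : learner),
    [/\ class_preserving H C, recursive_learner M, BC_learns H M C &
        conservative H M].

Definition SMonBC_learnable (C : set (set nat)) : Prop :=
  exists (H : nat -> set nat) (M : learner),
    [/\ class_preserving H C, recursive_learner M, BC_learns H M C &
        strongly_monotone H M].

(** * The sequence of least representatives exists and is unique *)

Lemma increasing_enum_sub (a b : nat -> nat) :
  {homo a : m n / m < n} -> {homo b : m n / m < n} ->
  range a `<=` range b -> forall n, b n <= a n.
Proof.
move=> ha hb sab.
have mb m n : m <= n -> b m <= b n.
  by rewrite leq_eqVlt => /predU1P[->//|/hb/ltnW].
elim=> [|n IH].
  have [m _ <-] : range b (a 0) by apply: sab; exists 0.
  exact: mb.
have [m _ bm] : range b (a n.+1) by apply: sab; exists n.+1.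
rewrite -bm; apply: (mb); rewrite ltnNge; apply/negP => /mb.
by rewrite bm => /leq_trans/(_ IH); rewrite leqNgt ha.
Qed.

Lemma least_reps_unique eta a b :
  least_reps eta a -> least_reps eta b -> a = b.
Proof.
move=> [ha ra] [hb rb]; apply/funext => n; apply/eqP; rewrite eqn_leq.
by rewrite !increasing_enum_sub// ra rb.
Qed.

Lemma least_reps_exists eta : positive_equivalence eta ->
  exists a, least_reps eta a.
Proof.
move=> [[er es et] _ inf].
pose P : set nat := [set x | forall y, eclass eta x y -> x <= y].
have least (Q : set nat) x : Q x ->
    exists2 y, Q y & forall z, Q z -> y <= z.
  elim/ltn_ind: x => x IH Qx.
  have [[z [zx Qz]]|noz] := pselect (exists z, z < x /\ Q z).
    exact: IH zx Qz.
  exists x => // z Qz; rewrite leqNgt; apply/negP => zx.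
  by apply: noz; exists z.
have repr x : exists2 p, P p & eclass eta p = eclass eta x.
  have [p px pmin] := least (eclass eta x) x (er x).
  have E : eclass eta p = eclass eta x.
    apply/seteqP; split=> y /= yp; first exact: (et _ _ _ yp px).
    exact: (et _ _ _ yp (es _ _ px)).
  by exists p => // y; rewrite E; exact: pmin.
have unb n : exists x, [/\ n <= x, P x & forall z, n <= z -> P z -> x <= z].
  have [[x [nx Px]]|no] := pselect (exists x, n <= x /\ P x).
    have [y [ny Py] ymin] := least [set z | n <= z /\ P z] x (conj nx Px).
    by exists y; split=> // z nz Pz; exact: ymin.
  exfalso; apply: inf.
  apply: (@sub_finite_set _ _ (eclass eta @` `I_n)).
    move=> _ [x _ <-]; have [p Pp <-] := repr x.
    exists p => //=; rewrite ltnNge; apply/negP => np; apply: no.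
    by exists p.
  by apply: finite_image; exact: finite_II.
have [f fP] := choice unb.
pose a n := iter n (fun y => f y.+1) (f 0).
have aS n : a n.+1 = f (a n).+1 by [].
exists a; split.
  apply: homo_ltn => [x y z|n]; first exact: ltn_trans.
  by rewrite aS; case: (fP (a n).+1).
have aP n : P (a n) by case: n => [|n]; rewrite ?aS; [case: (fP 0)|case: (fP (a n).+1)].
apply/seteqP; split=> [_ [n _ <-]|x Px]; first exact: aP.
have key n : (exists m, a m = x) \/ a n <= x.
  elim: n => [|n [|le]]; [|by left|].
    by right; have [_ _ ] := fP 0; apply.
  have [e|ne] := eqVneq (a n) x; first by left; exists n.
  have lt : a n < x by rewrite ltn_neqAle ne.
  by right; rewrite aS; have [_ _ ] := fP (a n).+1; apply.
have lin n : n <= a n.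
  elim: n => [//|n IH]; rewrite aS; apply: leq_ltn_trans IH _.
  by case: (fP (a n).+1).
have [[m <-]|] := key x.+1; first by exists m.
by move/(leq_ltn_trans)/(_ (ltnSn x))/(leq_ltn_trans (lin x.+1)); rewrite ltnn.
Qed.

(* Main.v *)
Require Import Defs.
From Corelib Require Import RelationClasses.
From Stdlib Require Cantor.
From mathcomp Require Import all_boot zify.
From mathcomp Require Import boolp classical_sets functions cardinality.

Set Implicit Arguments.
Unset Strict Implicit.
Unset Printing Implicit Defensive.

Local Open Scope classical_set_scope.

(** A learner that is conservative or strongly monotone on all texts is prudent:
    on data [s] it never conjectures more than the least member of the class that
    contains [cnt s]. The class is built so that no prudent learner exists.

    Let [e] code a hypothesis space [H] and a learner [M], let c = [slot e] =
    3e + 1 and let G be the union of the hypotheses [M] makes on data from [A c].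
    If [A c] is in the class, prudence and learning force G = [A c]; otherwise G
    is a union of members of the class none of which is [A c]. So it suffices to
    put [A c] in the class exactly when G is not [A c]. One index, the mover,
    starts at [A c] and moves up to [A c.+1] once G is seen to cover [A c]. As
    soon as G is seen to contain an element y that looks like [a c], a new index,
    a filler, is placed at [A c]. It may turn out later that y belongs to [A c];
    then the filler is sent up to a junk set [A n] reserved for it, with n a
    multiple of 3, and the next candidate y gets a filler of its own. Since the
    supply of fillers is unlimited, the unbounded number of such mistakes does
    no harm. *)

(** * Recursive functions *)

Lemma cfstK x y : cfst (cpair x y) = x.
Proof. by rewrite /cfst /cpair Cantor.cancel_of_to. Qed.

Lemma csndK x y : csnd (cpair x y) = y.
Proof. by rewrite /csnd /cpair Cantor.cancel_of_to. Qed.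

Lemma cpairK p : cpair (cfst p) (csnd p) = p.
Proof. by rewrite /cfst /csnd /cpair -surjective_pairing Cantor.cancel_to_of. Qed.

Lemma leq_cpair x y : x + y <= cpair x y.
Proof. have := Cantor.to_nat_non_decreasing x y; rewrite /cpair; lia. Qed.

Lemma cfst0 : cfst 0 = 0.
Proof. by []. Qed.

Lemma csnd0 : csnd 0 = 0.
Proof. by []. Qed.

Lemma computes_inj c x y z : computes c x y -> computes c x z -> y = z.
Proof.
elim: c x y z => [||||f IHf g IHg|f IHf g IHg|f IHf g IHg|f IHf] x y z /=;
  try by move=> -> ->.
- move=> [u [v [hu hv ->]]] [u' [v' [hu' hv' ->]]].
  by rewrite (IHf _ _ _ hu hu') (IHg _ _ _ hv hv').
- by move=> [u hu hy] [v hv]; rewrite -(IHg _ _ _ hu hv); apply: IHf.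
- elim: (csnd x) y z => [|n IH] y z /=; first exact: IHf.
  by move=> [u hu hy] [v hv]; rewrite -(IH _ _ hu hv); apply: IHg.
- move=> [y0 ylt] [z0 zlt]; case: (ltngtP y z) => // lt.
    by have [v hv] := zlt _ lt; have := IHf _ _ _ y0 hv.
  by have [v hv] := ylt _ lt; have := IHf _ _ _ z0 hv.
Qed.

Definition recursive (f : nat -> nat) : Prop :=
  exists c, forall x, computes c x (f x).

Lemma rec_comp f g : recursive f -> recursive g -> recursive (fun x => f (g x)).
Proof. by move=> [c hc] [d hd]; exists (Comp c d) => x; exists (g x). Qed.

Lemma rec_cpair f g :
  recursive f -> recursive g -> recursive (fun x => cpair (f x) (g x)).
Proof.
by move=> [c hc] [d hd]; exists (Pairing c d) => x; exists (f x), (g x); split.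
Qed.

Lemma rec_cfst f : recursive f -> recursive (fun x => cfst (f x)).
Proof. by apply: rec_comp; exists Fst. Qed.

Lemma rec_csnd f : recursive f -> recursive (fun x => csnd (f x)).
Proof. by apply: rec_comp; exists Snd. Qed.

Lemma rec_succ f : recursive f -> recursive (fun x => (f x).+1).
Proof. by apply: rec_comp; exists Succ. Qed.

Lemma rec_id : recursive (fun x => x).
Proof.
exists (Pairing Fst Snd) => x; exists (cfst x), (csnd x).
by split=> //; rewrite cpairK.
Qed.

Lemma rec_const k : recursive (fun=> k).
Proof. by elim: k => [|k]; [exists Zero | exact: rec_succ]. Qed.

Lemma rec_natrec f g n :
  recursive f ->
  recursive (fun p => g (cfst p) (cfst (csnd p)) (csnd (csnd p))) ->
  recursive n -> recursive (fun x => nat_rect (fun=> nat) (f x) (g x) (n x)).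
Proof.
move=> [c hc] [d hd] hn.
pose F p := nat_rect (fun=> nat) (f (cfst p)) (g (cfst p)) (csnd p).
have -> : (fun x => nat_rect (fun=> nat) (f x) (g x) (n x)) =
          (fun x => F (cpair x (n x))).
  by apply/funext => x; rewrite /F cfstK csndK.
apply: (@rec_comp F) (rec_cpair rec_id hn).
exists (Prec c d) => x /=; rewrite /F.
elim: (csnd x) => [|k IH] /=; first exact: hc.
eexists; first exact: IH.
set u := nat_rect _ _ _ k.
by have := hd (cpair (cfst x) (cpair k u)); rewrite !(cfstK, csndK).
Qed.

Lemma rec_iter f x n :
  recursive f -> recursive x -> recursive n ->
  recursive (fun p => iter (n p) f (x p)).
Proof.
move=> hf hx hn.
have -> : (fun p => iter (n p) f (x p)) =
    (fun p => nat_rect (fun=> nat) (x p) (fun _ => f) (n p)).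
  by apply/funext => p; elim: (n p) => //= k ->.
by apply: (rec_natrec (g := fun _ _ => f)) => //;
  apply/(rec_comp hf)/rec_csnd/rec_csnd/rec_id.
Qed.

Lemma rec_pred f : recursive f -> recursive (fun x => (f x).-1).
Proof.
move=> hf.
have -> : (fun x => (f x).-1) =
    (fun x => nat_rect (fun=> nat) 0 (fun i _ => i) (f x)).
  by apply/funext => x; case: (f x).
apply: (rec_natrec (f := fun=> 0) (g := fun _ i _ => i)) hf; first exact: rec_const.
exact/rec_cfst/rec_csnd/rec_id.
Qed.

Lemma rec_add f g : recursive f -> recursive g -> recursive (fun x => f x + g x).
Proof.
move=> hf hg.
have -> : (fun x => f x + g x) = (fun x => iter (g x) succn (f x)).
  by apply/funext => x; rewrite iter_succn addnC.
by apply: rec_iter => //; exists Succ.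
Qed.

Lemma rec_sub f g : recursive f -> recursive g -> recursive (fun x => f x - g x).
Proof.
move=> hf hg.
have -> : (fun x => f x - g x) = (fun x => iter (g x) predn (f x)).
  by apply/funext => x; rewrite iter_predn.
by apply: rec_iter => //; exact: (rec_pred rec_id).
Qed.

(** The test becomes a recursion of length |f x - g x| whose step ignores the previous value: length
    0 returns [h x], any other length [k x]. *)
Lemma rec_if f g h k :
  recursive f -> recursive g -> recursive h -> recursive k ->
  recursive (fun x => if f x == g x then h x else k x).
Proof.
move=> hf hg hh hk.
have -> : (fun x => if f x == g x then h x else k x) =
    (fun x => nat_rect (fun=> nat) (h x) (fun _ _ => k x) ((f x - g x) + (g x - f x))).
  apply/funext => x; case: eqP => [->|ne]; first by rewrite subnn.
  by have : 0 < f x - g x + (g x - f x); [lia | case: (_ + _)].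
apply: (rec_natrec (g := fun x _ _ => k x)) => //.
  exact: (rec_comp hk (rec_cfst rec_id)).
by apply: rec_add; apply: rec_sub.
Qed.

Ltac recursive_tac :=
  repeat lazymatch goal with
  | |- recursive cfst => apply: (rec_cfst rec_id)
  | |- recursive csnd => apply: (rec_csnd rec_id)
  | |- recursive predn => apply: (rec_pred rec_id)
  | |- recursive succn => apply: (rec_succ rec_id)
  | |- recursive (fun _ => cpair _ _) => apply: rec_cpair
  | |- recursive (fun _ => cfst _) => apply: rec_cfst
  | |- recursive (fun _ => csnd _) => apply: rec_csnd
  | |- recursive (fun _ => _.+1) => first [apply: rec_const | apply: rec_succ]
  | |- recursive (fun _ => _.-1) => apply: rec_pred
  | |- recursive (fun _ => _ + _) => apply: rec_add
  | |- recursive (fun _ => _ - _) => apply: rec_sub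
  | |- recursive (fun _ => iter _ _ _) => apply: rec_iter
  | |- recursive (fun _ => if _ then _ else _) => apply: rec_if
  | |- recursive _ => first [assumption | apply: rec_const | apply: rec_id]
  end.

(** * A universal machine *)

(** Frames of a stack machine, each awaiting a returned value. [FPrec g a i n] awaits stage [i] of a
    recursion that runs up to [n]; [FMini f x y] awaits the value of [f] at <x, y>. *)
Inductive frame : Type :=
  | FPair1 (g : code) (x : nat)
  | FPair2 (u : nat)
  | FComp (f : code)
  | FPrec (g : code) (a i n : nat)
  | FMini (f : code) (x y : nat).

Inductive state : Type :=
  | Eval (c : code) (x : nat) (K : seq frame)
  | Ret (v : nat) (K : seq frame).

Definition step (s : state) : state :=
  match s with
  | Eval c x K =>
    match c with
    | Zero => Ret 0 K
    | Succ => Ret x.+1 K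
    | Fst => Ret (cfst x) K
    | Snd => Ret (csnd x) K
    | Pairing f g => Eval f x (FPair1 g x :: K)
    | Comp f g => Eval g x (FComp f :: K)
    | Prec f g => Eval f (cfst x) (FPrec g (cfst x) 0 (csnd x) :: K)
    | Mini f => Eval f (cpair x 0) (FMini f x 0 :: K)
    end
  | Ret v [::] => s
  | Ret v (fr :: K) =>
    match fr with
    | FPair1 g x => Eval g x (FPair2 v :: K)
    | FPair2 u => Ret (cpair u v) K
    | FComp f => Eval f v K
    | FPrec g a i n =>
      if i == n then Ret v K
      else Eval g (cpair a (cpair i v)) (FPrec g a i.+1 n :: K)
    | FMini f x y =>
      if v == 0 then Ret y K else Eval f (cpair x y.+1) (FMini f x y.+1 :: K)
    end
  end.

Lemma computes_run c x y K :
  computes c x y -> exists n, iter n step (Eval c x K) = Ret y K.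
Proof.
have S s t : (exists n, iter n step (step s) = t) -> exists n, iter n step s = t.
  by move=> [n <-]; exists n.+1; rewrite iterSr.
have T s t u : (exists n, iter n step s = t) -> (exists n, iter n step t = u) ->
    exists n, iter n step s = u.
  by move=> [n <-] [m <-]; exists (m + n); rewrite iterD.
have Z s : exists n, iter n step s = s by exists 0.
elim: c x y K => [||||f IHf g IHg|f IHf g IHg|f IHf g IHg|f IHf] x y K /=;
  try by move=> ->; apply: S.
- move=> [u [v [hu hv ->]]]; apply/S/(T _ _ _ (IHf _ _ _ hu)).
  apply/S/(T _ _ _ (IHg _ _ _ hv)); exact/S.
- by move=> [u hu hy]; apply/S/(T _ _ _ (IHg _ _ _ hu))/S/IHf.
- move=> h; apply: (S) => /=; set a := cfst x in h *; move: (csnd x) h => n.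
  have loop i u : i <= n -> prec_graph (computes f) (computes g) a i u ->
      exists k, iter k step (Eval f a (FPrec g a 0 n :: K)) =
        Ret u (FPrec g a i n :: K).
    elim: i u => [|i IH] u lein /=; first exact: IHf.
    move=> [v /(IH _ (ltnW lein)) hv hu]; apply: (T _ _ _ hv); apply: (S) => /=.
    by rewrite ltn_eqF //; exact: IHg hu.
  by move=> /(loop _ _ (leqnn n)) h; apply: (T _ _ _ h); apply: (S) => /=; rewrite eqxx.
- move=> [hy hlt]; apply: (S) => /=.
  have loop z : z <= y ->
      exists k, iter k step (Eval f (cpair x 0) (FMini f x 0 :: K)) =
        Eval f (cpair x z) (FMini f x z :: K).
    elim: z => [//|z IH] ltzy; apply: (T _ _ _ (IH (ltnW ltzy))).
    have [v hv] := hlt _ ltzy; apply: (T _ _ _ (IHf _ _ _ hv)).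
    exact: S.
  by apply: (T _ _ _ (loop _ (leqnn y))); apply/(T _ _ _ (IHf _ _ _ hy))/S.
Qed.

(** A halting run must first finish the evaluation of [c]. The bound m < n on the steps that remain
    lets strong induction on [n] treat the sub-evaluations one after another. *)
Lemma run_computes n c x K v :
  iter n step (Eval c x K) = Ret v [::] ->
  exists m y, [/\ m < n, computes c x y & iter m step (Ret y K) = Ret v [::]].
Proof.
elim/ltn_ind: n c x K => -[//|n] IH c x K; rewrite iterSr.
case: c => [||||f g|f g|f g|f] /=;
  try by move=> h; exists n; eexists; split; [|reflexivity|exact: h].
- move=> /(IH _ (ltnSn n)) [[|m] [u [ltm hu]]] //; rewrite iterSr /= => h.
  have [|[|k] [w [ltk hw]]] // := IH m _ _ _ _ h; first by lia.
  rewrite iterSr /= => h'; exists k, (cpair u w); split=> //; first by lia.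
  by exists u, w.
- move=> /(IH _ (ltnSn n)) [[|m] [u [ltm hu]]] //; rewrite iterSr /= => h.
  have [|k [w [ltk hw h']]] := IH m _ _ _ _ h; first by lia.
  by exists k, w; split=> //; [lia | exists u].
- move=> /(IH _ (ltnSn n)) [m [u [ltm hu]]].
  (* Generalise from stage 0 to any stage [i] with value [u]; the inner induction is on the number
     [m] of steps left. *)
  have : prec_graph (computes f) (computes g) (cfst x) 0 u by [].
  have : 0 <= csnd x by [].
  move: 0 u m ltm {hu} => i u m.
  elim/ltn_ind: m i u => -[//|m] IHm i u ltm lei hu; rewrite iterSr /=.
  case: eqP hu => [->|ne] hu; first by move=> h; exists m, u; split=> //; lia.
  move=> h; have [|k [w [ltk hw h']]] := IH m _ _ _ _ h; first by lia.
  apply: (IHm k _ i.+1 w) h'; [lia|lia|lia|].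
  by exists u.
(* Loop invariant of the search: every z < y has already returned a nonzero value. *)
- suff loop k y : k <= n ->
      (forall z, z < y -> exists v, computes f (cpair x z) v.+1) ->
      iter k step (Eval f (cpair x y) (FMini f x y :: K)) = Ret v [::] ->
      exists m z, [/\ m < n.+1, computes (Mini f) x z &
        iter m step (Ret z K) = Ret v [::]] by exact: loop.
  elim/ltn_ind: k y => k IHk y lek hlt h.
  have [|[|m] [u [ltm hu]]] // := IH k _ _ _ _ h.
  rewrite iterSr /=; case: eqP hu => [->|ne] hu h'; first by exists m, y; split=> //; lia.
  apply: (IHk m _ y.+1) h'; [lia|lia|].
  move=> z; rewrite ltnS leq_eqVlt => /predU1P[->|/hlt//].
  by exists u.-1; rewrite prednK // lt0n; apply/eqP.
Qed.

(** * Coding of machine states by numbers *)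

Fixpoint encode_code (c : code) : nat :=
  match c with
  | Zero => cpair 0 0
  | Succ => cpair 1 0
  | Fst => cpair 2 0
  | Snd => cpair 3 0
  | Pairing f g => cpair 4 (cpair (encode_code f) (encode_code g))
  | Comp f g => cpair 5 (cpair (encode_code f) (encode_code g))
  | Prec f g => cpair 6 (cpair (encode_code f) (encode_code g))
  | Mini f => cpair 7 (encode_code f)
  end.

Definition encode_frame (fr : frame) : nat :=
  match fr with
  | FPair1 g x => cpair 0 (cpair (encode_code g) x)
  | FPair2 u => cpair 1 u
  | FComp f => cpair 2 (encode_code f)
  | FPrec g a i n => cpair 3 (cpair (encode_code g) (cpair a (cpair i n)))
  | FMini f x y => cpair 4 (cpair (encode_code f) (cpair x y))
  end.

Definition encode_stack (K : seq frame) : nat :=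
  foldr (fun fr k => (cpair (encode_frame fr) k).+1) 0 K.

Definition encode_state (s : state) : nat :=
  match s with
  | Eval c x K => cpair 0 (cpair (encode_code c) (cpair x (encode_stack K)))
  | Ret v K => cpair 1 (cpair v (encode_stack K))
  end.

(** Leads from the numerical halting test back to machine states; the tags separate [Eval] from
    [Ret], and a nonempty stack has a positive code. *)
Lemma encode_Ret_inj s v : encode_state s = encode_state (Ret v [::]) -> s = Ret v [::].
Proof.
case: s => [c x K|u K] /= /[dup] /(congr1 cfst) + /(congr1 csnd);
  rewrite !(cfstK, csndK) //.
move=> _ /[dup] /(congr1 cfst) + /(congr1 csnd); rewrite !(cfstK, csndK) => ->.
by case: K.
Qed.

Definition push (fr K : nat) : nat := (cpair fr K).+1.

Definition step_eval (c x K : nat) : nat :=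
  let t := cfst c in
  let f := cfst (csnd c) in
  let g := csnd (csnd c) in
  if t == 0 then cpair 1 (cpair 0 K) else
  if t == 1 then cpair 1 (cpair x.+1 K) else
  if t == 2 then cpair 1 (cpair (cfst x) K) else
  if t == 3 then cpair 1 (cpair (csnd x) K) else
  if t == 4 then cpair 0 (cpair f (cpair x (push (cpair 0 (cpair g x)) K))) else
  if t == 5 then cpair 0 (cpair g (cpair x (push (cpair 2 f) K))) else
  if t == 6 then cpair 0 (cpair f (cpair (cfst x)
    (push (cpair 3 (cpair g (cpair (cfst x) (cpair 0 (csnd x))))) K))) else
  cpair 0 (cpair (csnd c) (cpair (cpair x 0)
    (push (cpair 4 (cpair (csnd c) (cpair x 0))) K))).

Definition step_ret (v fr K : nat) : nat :=
  let t := cfst fr in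
  let d := csnd fr in
  if t == 0 then cpair 0 (cpair (cfst d) (cpair (csnd d) (push (cpair 1 v) K))) else
  if t == 1 then cpair 1 (cpair (cpair d v) K) else
  if t == 2 then cpair 0 (cpair d (cpair v K)) else
  let g := cfst d in
  let a := cfst (csnd d) in
  if t == 3 then
    let i := cfst (csnd (csnd d)) in
    let n := csnd (csnd (csnd d)) in
    if i == n then cpair 1 (cpair v K)
    else cpair 0 (cpair g (cpair (cpair a (cpair i v))
           (push (cpair 3 (cpair g (cpair a (cpair i.+1 n)))) K)))
  else
    let y := csnd (csnd d) in
    if v == 0 then cpair 1 (cpair y K)
    else cpair 0 (cpair g (cpair (cpair a y.+1)
           (push (cpair 4 (cpair g (cpair a y.+1))) K))).

Definition step_code (s : nat) : nat :=
  let d := csnd s in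
  if cfst s == 0 then step_eval (cfst d) (cfst (csnd d)) (csnd (csnd d)) else
  if csnd d == 0 then s else
  step_ret (cfst d) (cfst (csnd d).-1) (csnd (csnd d).-1).

Lemma step_codeE s : step_code (encode_state s) = encode_state (step s).
Proof.
case: s => [c x K|v K]; rewrite /step_code /= !(cfstK, csndK) /=.
  by rewrite /step_eval; case: c => *; rewrite /= ?(cfstK, csndK).
case: K => [//|fr K] /=; rewrite !(cfstK, csndK) /step_ret.
case: fr => [g x|u|f|g a i n|f x y]; rewrite /= ?(cfstK, csndK) //=.
  by case: ifP.
by case: ifP.
Qed.

Lemma rec_step_eval c x K : recursive c -> recursive x -> recursive K ->
  recursive (fun p => step_eval (c p) (x p) (K p)).
Proof. by move=> *; rewrite /step_eval /push; recursive_tac. Qed.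

Lemma rec_step_ret v fr K : recursive v -> recursive fr -> recursive K ->
  recursive (fun p => step_ret (v p) (fr p) (K p)).
Proof. by move=> *; rewrite /step_ret /push /=; recursive_tac. Qed.

Lemma rec_step_code : recursive step_code.
Proof.
apply: rec_if; first by recursive_tac.
- exact: rec_const.
- by apply: rec_step_eval; recursive_tac.
- by apply: rec_if; try apply: rec_step_ret; recursive_tac.
Qed.

(** A version of Kleene's T predicate. The two numbers compared are the code of the [n]-th state of
    the run and that of [Ret y [::]]; halted states are fixed by the step function, so [n] may
    exceed the running time. *)
Definition halts (e x y n : nat) : bool :=
  iter n step_code (cpair 0 (cpair e (cpair x 0))) == cpair 1 (cpair y 0).

Lemma computesE c x y : computes c x y <-> exists n, halts (encode_code c) x y n.
Proof.
have E n : iter n step_code (cpair 0 (cpair (encode_code c) (cpair x 0))) =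
    encode_state (iter n step (Eval c x [::])).
  by elim: n => //= n ->; rewrite step_codeE.
split=> [/(computes_run [::]) [n h]|[n]]; first by exists n; rewrite /halts E h.
rewrite /halts E => /eqP/encode_Ret_inj/run_computes [m [z [_ h e]]].
suff <- : z = y by [].
by move: e; elim: m => [[]|m IH] //; rewrite iterSr.
Qed.

Lemma rec_halts e x y n : recursive e -> recursive x -> recursive y -> recursive n ->
  recursive (fun p => if halts (e p) (x p) (y p) (n p) then 0 else 1).
Proof. by move=> *; recursive_tac; exact: rec_step_code. Qed.

(** * Recursively enumerable predicates *)

Lemma re_sigma q : recursive q -> re [set x | exists n, q (cpair x n) = 0].
Proof.
move=> [c hc]; exists (Mini c); apply/seteqP; split=> x /=.
  move=> [n /eqP hn].
  have [m /eqP hm min] := ex_minnP (ex_intro (fun n => q (cpair x n) == 0) n hn).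
  exists m; split=> [|z ltzm]; first by rewrite -hm.
  exists (q (cpair x z)).-1; rewrite prednK; first exact: hc.
  by rewrite lt0n; apply: contraTN ltzm => /min; rewrite leqNgt.
by move=> [n [h0 _]]; exists n; exact: computes_inj (hc _) h0.
Qed.

(** Kleene's normal form; the single witness packs an output together with a number of steps. *)
Lemma re_normal_form P : re P ->
  exists2 q, recursive q & forall x, P x <-> exists n, q (cpair x n) = 0.
Proof.
move=> [c ->].
exists (fun p =>
  if halts (encode_code c) (cfst p) (cfst (csnd p)) (csnd (csnd p)) then 0 else 1).
  by apply: rec_halts; recursive_tac.
move=> x; split=> [[y /computesE[n h]]|[p]] /=.
  by exists (cpair y n); rewrite !(cfstK, csndK) h.
rewrite !(cfstK, csndK); case: ifP => // h _.
by exists (cfst (csnd (cpair x p))); apply/computesE; exists (csnd p); rewrite csndK.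
Qed.

Lemma re_ext (P Q : nat -> Prop) : (forall x, P x <-> Q x) -> re P -> re Q.
Proof. by move=> h; have -> : P = Q by apply/funext => x; apply/propext. Qed.

Lemma re_comp (P : nat -> Prop) f : re P -> recursive f -> re (fun x => P (f x)).
Proof.
move=> [c ->] [d hd]; exists (Comp c d); apply/seteqP; split=> x /=.
  by move=> [y hy]; exists y, (f x).
by move=> [y [u hu hy]]; exists y; rewrite (computes_inj (hd x) hu).
Qed.

Lemma re_eq f g : recursive f -> recursive g -> re (fun x => f x = g x).
Proof.
move=> hf hg.
apply: re_ext (@re_sigma (fun p => if f (cfst p) == g (cfst p) then 0 else 1) _).
  move=> x; split=> [[n]|e]; first by rewrite cfstK; case: eqP.
  by exists 0; rewrite cfstK e eqxx.
recursive_tac.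
  by apply: (rec_comp hf); recursive_tac.
by apply: (rec_comp hg); recursive_tac.
Qed.

Lemma re_and (P Q : nat -> Prop) : re P -> re Q -> re (fun x => P x /\ Q x).
Proof.
move=> [c ->] [d ->]; exists (Pairing c d); apply/seteqP; split=> x /=.
  by move=> [[u hu] [v hv]]; exists (cpair u v), u, v.
by move=> [_ [u [v [hu hv _]]]]; split; [exists u | exists v].
Qed.

Lemma re_ex (P : nat -> nat -> Prop) :
  re (fun p => P (cfst p) (csnd p)) -> re (fun x => exists y, P x y).
Proof.
move=> /re_normal_form [q hq E].
apply: re_ext (@re_sigma
  (fun p => q (cpair (cpair (cfst p) (cfst (csnd p))) (csnd (csnd p)))) _).
  move=> x; split=> [[n]|[y]].
    rewrite !(cfstK, csndK) => h; exists (cfst n).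
    by have [_] := E (cpair x (cfst n)); rewrite cfstK csndK; apply; exists (csnd n).
  move=> h; have [] := E (cpair x y); rewrite cfstK csndK => /(_ h) [n hn] _.
  by exists (cpair y n); rewrite !(cfstK, csndK).
by apply: (rec_comp hq); recursive_tac.
Qed.

(** A primitive recursion runs the semi-decision procedure on z = 0, 1, ... in turn and discards the
    outputs; it converges exactly when every run does. *)
Lemma re_all_lt (P : nat -> nat -> Prop) n :
  re (fun p => P (cfst p) (csnd p)) -> recursive n ->
  re (fun x => forall z, z < n x -> P x z).
Proof.
move=> [c hc] hn.
have EP x z : P x z <-> exists y, computes c (cpair x z) y.
  have := congr1 (fun A : set nat => A (cpair x z)) hc.
  by rewrite /= cfstK csndK => ->.
suff h : re (fun p => forall z, z < csnd p -> P (cfst p) z).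
  apply: re_ext (@re_comp _ (fun x => cpair x (n x)) h _).
    by move=> x; rewrite cfstK csndK.
  by recursive_tac.
exists (Prec Zero (Comp c (Pairing Fst (Comp Fst Snd)))).
apply/seteqP; split=> p /=; move: (cfst p) (csnd p) => x m.
  elim: m => [|m IH] hP; first by exists 0.
  have [u hu] := IH (fun z ltzm => hP z (ltnW ltzm)).
  have /EP[y hy] := hP m (ltnSn m).
  exists y, u => //; exists (cpair x m) => //.
  exists x, m; split=> //; first by rewrite cfstK.
  by exists (cpair m u); rewrite ?(cfstK, csndK).
elim: m => [//|m IH] [y [u hu [w [a [b [-> [d -> ->] ->]]]]]] hy z.
rewrite ltnS leq_eqVlt => /predU1P[->|]; last by apply: IH; exists u.
by apply/EP; exists y; move: hy; rewrite !(cfstK, csndK).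
Qed.

(** Running one procedure after the other could diverge on the first, so both normal forms are
    searched with a common witness. *)
Lemma re_or (P Q : nat -> Prop) : re P -> re Q -> re (fun x => P x \/ Q x).
Proof.
move=> /re_normal_form[p hp EP] /re_normal_form[q hq EQ].
apply: re_ext (@re_sigma (fun x => if p x == 0 then 0 else q x) _); last first.
  by recursive_tac.
move=> x; split=> [[n]|].
  by case: eqP => h h'; [left; apply/EP | right; apply/EQ]; exists n.
by move=> [/EP|/EQ] [n h]; exists n; rewrite h //; case: eqP.
Qed.

Lemma re_computes e x y : recursive e -> recursive x -> recursive y ->
  re (fun p => exists n, halts (e p) (x p) (y p) n).
Proof.
move=> he hx hy.
apply: re_ext (@re_sigma (fun p =>
  if halts (e (cfst p)) (x (cfst p)) (y (cfst p)) (csnd p) then 0 else 1) _).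
  move=> p; split=> [[n]|[n h]]; last by exists n; rewrite !(cfstK, csndK) h.
  by rewrite !(cfstK, csndK); case: ifP => // h _; exists n.
by apply: rec_halts; recursive_tac; apply: (@rec_comp _ cfst) => //; recursive_tac.
Qed.

(** The stage [t] packs a candidate and a witness for it; a stage whose witness fails outputs the
    default 0, which is why 0 must belong to every set. *)
Lemma uniform_enumeration (X : nat -> nat -> Prop) :
  re (fun p => X (cfst p) (csnd p)) -> (forall e, X e 0) ->
  exists2 y : nat -> nat -> nat, recursive (fun p => y (cfst p) (csnd p)) &
    forall e x, X e x <-> exists t, y e t = x.
Proof.
move=> /re_normal_form[q hq E] X0.
exists (fun e t => if q (cpair (cpair e (cfst t)) (csnd t)) == 0 then cfst t else 0).
  by recursive_tac; apply: (rec_comp hq); recursive_tac.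
move=> e x; have {}E z : X e z <-> exists n, q (cpair (cpair e z) n) = 0.
  by have := E (cpair e z); rewrite cfstK csndK.
split=> [/E[n h]|[t]]; first by exists (cpair x n); rewrite !(cfstK, csndK) h.
case: eqP => [h <-|_ <-]; last exact: X0.
by apply/E; exists (csnd t).
Qed.

(** A number is read as an infinite list by iterated unpairing, so one number can carry any
    prescribed finite beginning. *)
Definition nth_code (w i : nat) : nat := cfst (iter i csnd w).

Lemma nth_code_exists (u : nat -> nat) n :
  exists w, forall i, i < n -> nth_code w i = u i.
Proof.
elim: n u => [|n IH] u; first by exists 0.
have [w hw] := IH (u \o succn); exists (cpair (u 0) w) => -[|i] ltin.
  by rewrite /nth_code cfstK.
by rewrite /nth_code iterSr csndK -/(nth_code w i) hw.
Qed.

Lemma rec_nth_code w i : recursive w -> recursive i ->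
  recursive (fun p => nth_code (w p) (i p)).
Proof. by move=> *; rewrite /nth_code; recursive_tac; exists Snd. Qed.

(** * The ascending family *)

Section AscendingFamily.
Variables (eta : nat -> nat -> Prop) (a : nat -> nat).
Hypotheses (eta_pos : positive_equivalence eta) (a_reps : least_reps eta a).

Notation A := (A_ eta a).

Lemma eta_equiv : Equivalence eta.
Proof. by case: eta_pos. Qed.

Let eta_refl x : eta x x := @Equivalence_Reflexive _ _ eta_equiv x.
Let eta_sym x y : eta x y -> eta y x := @Equivalence_Symmetric _ _ eta_equiv x y.
Let eta_trans x y z : eta x y -> eta y z -> eta x z :=
  @Equivalence_Transitive _ _ eta_equiv x y z.

Lemma a_mono m n : (a m < a n) = (m < n).
Proof. by have [h _] := a_reps; exact: (leqW_mono (leq_mono h)). Qed.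

Lemma a_le m n : (a m <= a n) = (m <= n).
Proof. by have [h _] := a_reps; exact: (leq_mono h). Qed.

Lemma a_least m y : eta y (a m) -> a m <= y.
Proof.
have [_ r] := a_reps; have : range a (a m) by exists m.
by rewrite r => h /h.
Qed.

Lemma eta_rep x : exists m, eta x (a m).
Proof.
elim/ltn_ind: x => x IH.
have [[y [ltyx xy]]|no] := pselect (exists y, y < x /\ eta x y).
  by have [m ym] := IH _ ltyx; exists m; exact: eta_trans xy ym.
have [_ r] := a_reps.
have [m _ <-] : range a x; last by exists m.
rewrite r => y /= yx; rewrite leqNgt; apply/negP => lt; apply: no.
by exists y; split=> //; exact: eta_sym.
Qed.

Lemma eta_a_inj m n : eta (a m) (a n) -> m = n.
Proof.
move=> h; apply/eqP; rewrite eqn_leq -a_le (a_least (eta_sym h)) -a_le.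
exact: a_least h.
Qed.

Lemma in_A n x : A n x <-> exists m, m < n /\ eta x (a m).
Proof. by split=> [[m /= h1 h2]|[m [h1 h2]]]; exists m. Qed.

Lemma A_eta n x y : eta x y -> A n y -> A n x.
Proof.
by move=> xy /in_A[m [ltm ym]]; apply/in_A; exists m; split=> //; apply: eta_trans ym.
Qed.

Lemma A_rep n m x : eta x (a m) -> A n x <-> m < n.
Proof.
move=> xm; split=> [/in_A[k [ltk xk]]|lt]; last by apply/in_A; exists m.
by rewrite (@eta_a_inj m k) //; apply: eta_trans xk; exact: eta_sym.
Qed.

Lemma A_a n m : A n (a m) <-> m < n.
Proof. exact: A_rep. Qed.

Lemma A_lt n x : x < a n -> A n x.
Proof.
move=> lt; have [m xm] := eta_rep x; apply/(A_rep n xm); rewrite -a_mono.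
exact: leq_ltn_trans (a_least xm) lt.
Qed.

Lemma A_sub m n : (A m `<=` A n) <-> m <= n.
Proof.
split=> [h|le x /in_A[k [ltk xk]]].
  by case: m h => // m /(_ (a m)) h; apply/A_a/h/A_a.
by apply/in_A; exists k; split=> //; exact: leq_trans le.
Qed.

Lemma A_inj : injective A.
Proof.
by move=> m n e; apply/eqP; rewrite eqn_leq; apply/andP; split; apply/A_sub; rewrite e.
Qed.

Lemma A_succ n x : A n.+1 x <-> A n x \/ eta x (a n).
Proof.
have [m xm] := eta_rep x; rewrite !(A_rep _ xm) ltnS leq_eqVlt; split.
  by move=> /predU1P[<-|->]; [right | left].
case=> [->|xn]; first by rewrite orbT.
by rewrite (@eta_a_inj m n) ?eqxx //; apply: eta_trans xn; exact: eta_sym.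
Qed.

Lemma A_eta_closed n : eta_closed eta (A n).
Proof.
exists [set a m | m in [set m | m < n]]; apply/seteqP; split=> x.
  by move=> [m ltm xm]; exists (a m) => //; exists m.
by move=> [_ [m ltm <-] xm]; exists m.
Qed.

Lemma re_eta x y : recursive x -> recursive y -> re (fun p => eta (x p) (y p)).
Proof.
move=> hx hy; have [_ h _] := eta_pos.
apply: re_ext (re_comp h (rec_cpair hx hy)) => p /=.
by rewrite cfstK csndK.
Qed.

(* An initial segment [{0,...,y}] lies in [A n] exactly when it meets at most
   [n] classes, i.e. when it is covered by the classes of [n] elements. *)
Lemma A_re_def n x : A n x <->
  exists y, eta x y /\ exists w, forall z, z < y.+1 ->
    exists i, i.+1 - n = 0 /\ eta z (nth_code w i).
Proof.
split=> [/in_A[m [ltm xm]]|[y [xy [w hw]]]].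
  have [w hw] := nth_code_exists a n.
  exists (a m); split=> //; exists w => z ltz; have [k zk] := eta_rep z.
  have ltk : k < n.
    by apply: leq_ltn_trans ltm; rewrite -a_le -ltnS (leq_ltn_trans (a_least zk)).
  by exists k; split; [lia | rewrite hw].
apply: A_eta xy _; have [k yk] := eta_rep y; apply/(A_rep n yk).
rewrite ltnNge; apply/negP => lenk.
(* Pigeonhole: if n <= k, then a 0, ..., a n all lie below [y], but these n + 1 inequivalent
   elements would be covered by n classes. *)
have h (j : 'I_n.+1) : exists i : 'I_n, eta (a j) (nth_code w i).
  have [|i [lti e]] := hw (a j).
    rewrite ltnS; apply: leq_trans (a_least yk); rewrite a_le.
    by apply: leq_trans lenk; rewrite -ltnS.
  have lt : i < n by lia.
  by exists (Ordinal lt).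
have [f hf] := choice h.
have /leq_card : injective f.
  move=> i j e; apply/val_inj/(@eta_a_inj i j)/(eta_trans (hf i)).
  by rewrite e; exact: eta_sym.
by rewrite !card_ord ltnn.
Qed.

Lemma re_A n x : recursive n -> recursive x -> re (fun p => A (n p) (x p)).
Proof.
move=> hn hx.
apply: re_ext (fun p => iff_sym (A_re_def (n p) (x p))) _.
apply: re_ex; apply: re_and.
  by apply: re_eta; recursive_tac; apply: (rec_comp hx); recursive_tac.
apply: re_ex; apply: re_all_lt; last by recursive_tac.
apply: re_ex; apply: re_and.
  apply: re_eq; recursive_tac.
  by apply: (rec_comp hn); recursive_tac.
apply: re_eta; first by recursive_tac.
by apply: rec_nth_code; recursive_tac.
Qed.

(** * The diagonal family for a uniformly r.e. sequence of sets *)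

Section Diagonal.
Variables (G : nat -> nat -> Prop).
Hypothesis G_re : re (fun p => G (cfst p) (csnd p)).

Let re_G e x : recursive e -> recursive x -> re (fun p => G (e p) (x p)).
Proof.
move=> he hx; apply: re_ext (re_comp G_re (rec_cpair he hx)) => p.
by rewrite cfstK csndK.
Qed.

(** The indices 3e + 1 and 3e + 2 are reserved for [e], and multiples of 3 for junk, so residues
    modulo 3 prevent most collisions. *)
Definition slot (e : nat) : nat := (e + e + e).+1.

Let rec_slot e : recursive e -> recursive (fun p => slot (e p)).
Proof. by move=> *; rewrite /slot; recursive_tac. Qed.

(** The set [S] need not be closed under [eta], so meeting the class of [a n] replaces containing
    [a n]. *)
Definition reaches (S : nat -> Prop) (n : nat) : Prop :=
  exists x, eta x (a n) /\ S x.

(* The next set after [S]: for [S = A m] its closure is [A m.+1]. *)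
Definition cover_succ (S : nat -> Prop) (x : nat) : Prop :=
  exists w, forall z, z < x.+1 -> S z \/ eta z w.

(** The slot of [e] stays vacant in one case only: the mover has left because [cover_succ (G e)]
    reaches it, and no filler remains because [G e] does not. Conversely, a filler remains only if
    [G e] reaches the slot, which also drives the mover away; hence no two indices share it. *)
Lemma diagonal_family :
  exists f : nat -> nat,
    [/\ injective f, uniformly_re (A \o f) &
        forall e, (exists k, f k = slot e) <->
          reaches (G e) (slot e) \/ ~ reaches (cover_succ (G e)) (slot e)].
Proof.
(* The candidates [y e t] enumerate [G e] within [A (slot e).+1]. The default 0 is harmless: it lies
   in [A (slot e)], so as a candidate it is stale. *)
have [|e|y rec_y Ey] := @uniform_enumeration
    (fun e x => x = 0 \/ (A (slot e).+1 x /\ G e x)).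
- apply: re_or; first by apply: re_eq; recursive_tac.
  apply: re_and; last exact: G_re.
  by apply: re_A; recursive_tac; apply: rec_slot; recursive_tac.
- by left.
(* Inequalities are written as vanishing truncated differences, to suit [re_eq]. *)
pose mover e x := A (slot e) x \/
  (A (slot e).+1 x /\ exists z, eta x z /\ (G e z \/ cover_succ (G e) z)).
(* This is 3k + 3 for the filler's own index k = cpair e t.+1: distinct fillers get distinct junk
   sets, and each lies above [slot e], so a filler can grow into it. *)
pose junk e t := (cpair e t.+1 + cpair e t.+1 + cpair e t.+1).+3.
(* Of the candidates [y e t] equivalent to [a (slot e)] only the first is not stale,
   so at most one filler stays at [A (slot e)]. *)
pose stale e t := A (slot e) (y e t) \/
  exists t', t'.+1 - t = 0 /\ eta (y e t) (y e t').
pose filler e t x := A (slot e) x \/ (A (junk e t) x /\ stale e t).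
(* Index <e, 0> is the mover of [e] and <e, t.+1> its filler for candidate [t]; [1 - csnd k = 0]
   expresses that the second component is positive. *)
pose B k x := (csnd k = 0 /\ mover (cfst k) x) \/
  (1 - csnd k = 0 /\ filler (cfst k) (csnd k).-1 x).
have B0 e : B (cpair e 0) = mover e.
  apply/funext => x; apply/propext; rewrite /B !(cfstK, csndK).
  by split=> [[[_]//|[]//]|]; left.
have BS e t : B (cpair e t.+1) = filler e t.
  apply/funext => x; apply/propext; rewrite /B !(cfstK, csndK).
  by split=> [[[]//|[_]//]|]; right.
have mover1 e : reaches (G e) (slot e) \/ reaches (cover_succ (G e)) (slot e) ->
    mover e = A (slot e).+1.
  move=> h; apply/funext => x; apply/propext; rewrite /mover A_succ.
  split=> [[|[]]//|[|xa]]; [by left | by left | right; split; first by right].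
  by case: h => -[z [za hz]]; exists z; (split; [exact: eta_trans (eta_sym za) | tauto]).
have mover0 e : ~ (reaches (G e) (slot e) \/ reaches (cover_succ (G e)) (slot e)) ->
    mover e = A (slot e).
  move=> h; apply/funext => x; apply/propext; rewrite /mover A_succ.
  split=> [[//|[[//|xa] [z [xz hz]]]]|]; last by left.
  case: h; have za : eta z (a (slot e)) by exact: eta_trans (eta_sym xz) xa.
  by case: hz => hz; [left|right]; exists z.
have slot_junk e t : slot e < junk e t.
  by have := leq_cpair e t.+1; rewrite /slot /junk; lia.
have filler1 e t : stale e t -> filler e t = A (junk e t).
  move=> h; apply/funext => x; apply/propext; rewrite /filler.
  split=> [[|[]//]|]; last by right.
  by have /A_sub := ltnW (slot_junk e t); apply.
have filler0 e t : ~ stale e t -> filler e t = A (slot e).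
  by move=> h; apply/funext => x; apply/propext; split=> [[|[_]]//|]; left.
have y_in e t : A (slot e).+1 (y e t) /\ (A (slot e) (y e t) \/ G e (y e t)).
  have /Ey : exists t', y e t' = y e t by exists t.
  case=> [->|[h1 h2]]; last by tauto.
  have -> : 0 = a 0; last by split; [|left]; apply/A_a.
  have [m h] := eta_rep 0; have := a_least h; rewrite leqn0 => /eqP e0.
  by apply/eqP; rewrite eq_sym -leqn0 -[X in _ <= X]e0 a_le.
have fresh e t : ~ stale e t -> [/\ eta (y e t) (a (slot e)), G e (y e t) &
    forall t', eta (y e t') (a (slot e)) -> t <= t'].
  move=> /not_orP[h1 h2]; have [/A_succ[//|h3] [//|h4]] := y_in e t; split=> // t' h5.
  rewrite leqNgt; apply/negP => lt; apply: h2; exists t'; split; first by lia.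
  exact: eta_trans h3 (eta_sym h5).
(* The final position of each index, with the reason for remaining at a slot. It is obtained
   classically; enumerability is shown for [B], not through [f]. *)
have ex_f k : exists n, B k = A n /\ (csnd k = 0 /\
   ((n = slot (cfst k) /\
     ~ (reaches (G (cfst k)) n \/ reaches (cover_succ (G (cfst k))) n)) \/
     n = (slot (cfst k)).+1) \/
   csnd k <> 0 /\
   ((n = slot (cfst k) /\ ~ stale (cfst k) (csnd k).-1) \/ n = (k + k + k).+3)).
  rewrite -(cpairK k) !(cfstK, csndK); move: (cfst k) (csnd k) => e [|t]; rewrite ?B0 ?BS.
    have [h|h] := pselect (reaches (G e) (slot e) \/ reaches (cover_succ (G e)) (slot e)).
      by exists (slot e).+1; rewrite mover1 //; split=> //; left; split=> //; right.
    by exists (slot e); rewrite mover0 //; split=> //; left; split=> //; left.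
  have [h|h] := pselect (stale e t).
    by exists (junk e t); rewrite filler1 //; split=> //; right; split=> //; right.
  by exists (slot e); rewrite filler0 //; split=> //; right; split=> //; left.
have [f hf] := choice ex_f; exists f.
have AfB : A \o f = B by apply/funext => k; case: (hf k).
have cpair_eq k k' : cfst k = cfst k' -> csnd k = csnd k' -> k = k'.
  by move=> e1 e2; rewrite -(cpairK k) -(cpairK k') e1 e2.
have slot_inj e e' : slot e = slot e' -> e = e' by rewrite /slot; lia.
have noclash e t : ~ (reaches (G e) (slot e) \/ reaches (cover_succ (G e)) (slot e)) ->
    ~ stale e t -> False.
  by move=> h /fresh[h1 h2 _]; apply: h; left; exists (y e t).
split.
- move=> k k' eqf; have [_] := hf k; have [_] := hf k'; rewrite -{}eqf.
  move: (f k) => n.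
  (* Arithmetic modulo 3 settles all pairs except those that meet in one slot: mover and filler, in
     either order, or two fillers. *)
  case=> -[s' [[n' h'] | n']]; case=> -[s [[n0 h] | n0]];
    try (by rewrite /slot in n0 n'; lia);
    try (by apply: cpair_eq; rewrite /slot in n0 n'; lia).
  + have e : cfst k = cfst k' by apply: slot_inj; rewrite -n0.
    by rewrite e in h; rewrite n' in h'; case: (noclash _ _ h' h).
  + have e : cfst k = cfst k' by apply: slot_inj; rewrite -n0.
    by rewrite -e in h'; rewrite n0 in h; case: (noclash _ _ h h').
  + have e : cfst k = cfst k' by apply: slot_inj; rewrite -n0.
    apply: cpair_eq => //; rewrite -e in h'.
    have [h1 _ h2] := fresh _ _ h; have [h3 _ h4] := fresh _ _ h'.
    by have := h2 _ h3; have := h4 _ h1; lia.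
- rewrite AfB /uniformly_re /re_rel.
  have rec_yy e t : recursive e -> recursive t -> recursive (fun p => y (e p) (t p)).
    move=> he ht; have := rec_comp rec_y (rec_cpair he ht); congr recursive.
    by apply/funext => p; rewrite cfstK csndK.
  rewrite /B /mover /filler /stale /junk /cover_succ /slot.
  repeat first [ apply: re_or | apply: re_and | apply: re_ex | apply: re_all_lt
    | apply: re_eq | apply: re_eta | apply: re_A | apply: re_G ];
  repeat first [ progress recursive_tac | apply: rec_yy | apply: rec_nth_code ].
move=> e; split=> [[k fk]|].
  have [_] := hf k; rewrite fk; case=> -[s [[/slot_inj ek h]|n0]];
    try (by rewrite /slot in n0; lia).
  - by right=> h'; apply: h; right; rewrite -ek.
  - left; have [h1 h2 _] := fresh _ _ h; rewrite -ek in h1 h2.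
    by exists (y e (csnd k).-1).
have eqA e' k : B k = A (slot e') -> f k = slot e'.
  by move=> h; apply: A_inj; rewrite -h; have [-> _] := hf k.
(* The filler of the first candidate equivalent to [a (slot e)] never becomes stale. *)
have reached : reaches (G e) (slot e) -> exists k, f k = slot e.
  move=> [x [xa Gx]].
  have [t yt] : exists t, y e t = x by apply/Ey; right; split=> //; apply/A_succ; right.
  pose P t := `[< eta (y e t) (a (slot e)) >].
  have exP : exists t, P t by exists t; apply/asboolP; rewrite yt.
  have [t0 /asboolP Pt0 min] := ex_minnP exP.
  exists (cpair e t0.+1); apply: eqA; rewrite BS filler0 //.
  case=> [/(A_rep _ Pt0)|[t' [lt e']]]; first by rewrite ltnn.
  have /min : P t' by apply/asboolP/(eta_trans (eta_sym e')).
  by lia.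
case=> [/reached//|h]; have [/reached//|h'] := pselect (reaches (G e) (slot e)).
by exists (cpair e 0); apply: eqA; rewrite B0 mover0 // => -[].
Qed.
End Diagonal.
End AscendingFamily.

(** * Learners *)

(** Reading past the end of the coded sequence yields 0, the code of the pause symbol. *)
Definition symbol_at (k j : nat) : nat := cfst (iter j (fun k => csnd k.-1) k).-1.

(** A sequence is no longer than its code, so [k] bounds the positions and the surplus ones read as
    pauses. The quantifier is thus bounded, which preserves enumerability. *)
Definition content_in (S : nat -> Prop) (k : nat) : Prop :=
  forall j, j < k -> symbol_at k j = 0 \/ S (symbol_at k j).-1.

Lemma symbol_at_encode s j : symbol_at (encode_seq s) j = encode_symbol (nth None s j).
Proof.
elim: s j => [|o s IH] j.
  rewrite /symbol_at nth_nil /=; have -> : iter j (fun k => csnd k.-1) 0 = 0.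
    by elim: j => //= j ->; rewrite /= csnd0.
  exact: cfst0.
case: j => [|j]; first by rewrite /symbol_at /= cfstK.
by rewrite /symbol_at iterSr /= csndK; exact: IH.
Qed.

Lemma size_encode_seq s : size s <= encode_seq s.
Proof.
elim: s => //= o s IH; rewrite ltnS; apply: leq_trans IH _.
by have := leq_cpair (encode_symbol o) (encode_seq s); lia.
Qed.

Lemma encode_seq_surj k : exists s, encode_seq s = k.
Proof.
elim/ltn_ind: k => -[|k] IH; first by exists [::].
have lek := leq_cpair (cfst k) (csnd k); rewrite cpairK in lek.
have [|s hs] := IH (csnd k); first by lia.
exists ((if cfst k is x.+1 then Some x else None) :: s) => /=.
by rewrite hs -[in RHS](cpairK k); case: (cfst k).
Qed.

Lemma content_inE s S : content_in S (encode_seq s) <-> cnt s `<=` S.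
Proof.
split=> [h x /(nthP None)[j ltj e]|h j _]; rewrite ?symbol_at_encode.
  have /h : j < encode_seq s by exact: leq_trans (size_encode_seq s).
  by rewrite symbol_at_encode e /= => -[].
case e: (nth None s j) => [x|]; [right | by left].
apply: h; rewrite /cnt /= -e mem_nth // ltnNge; apply/negP => le.
by rewrite nth_default in e.
Qed.

Lemma prefix_of_self (T : text) n : size (prefix_of T n) = n.
Proof. exact: size_mkseq. Qed.

Lemma text_extending s (L : set nat) : cnt s `<=` L ->
  exists T : text, text_for T L /\ prefix_of T (size s) = s.
Proof.
move=> sL.
(* After [s], position size s + x presents [x] if it belongs to [L] and a pause otherwise. *)
exists (fun n => if n < size s then nth None s n
  else if `[< L (n - size s) >] then Some (n - size s) else None); split.
  apply/seteqP; split=> x /=.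
    move=> [n]; case: ifP => lt.
      by move=> e; apply: sL; rewrite /cnt /= -e mem_nth.
    by case: asboolP => // h [<-].
  move=> Lx; exists (x + size s); rewrite ltnNge leq_addl /= addnK.
  by case: asboolP.
apply: (@eq_from_nth _ None); first by rewrite prefix_of_self.
by move=> i; rewrite prefix_of_self => lt; rewrite /prefix_of nth_mkseq // lt.
Qed.

Lemma cnt_prefix (T : text) L n : text_for T L -> cnt (prefix_of T n) `<=` L.
Proof. by move=> <- x /mapP[i _ e]; exists i. Qed.

(** * Prudence of conservative and of strongly monotone learners *)

Definition prudent (H : nat -> set nat) (M : learner) (C : set (set nat)) : Prop :=
  forall s i L, M s = Some i -> C L -> cnt s `<=` L -> H i `<=` L.

Lemma BC_eventually H M C s L : BC_learns H M C -> C L -> cnt s `<=` L ->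
  exists T k j, [/\ 0 < k, prefix_of T (size s) = s,
    cnt (prefix_of T (size s + k)) `<=` L, M (prefix_of T (size s + k)) = Some j &
    H j = L].
Proof.
move=> bc CL sL; have [T [TL Ts]] := text_extending sL.
have [n0 hn0] := bc L CL T TL.
have [j hj Hj] := hn0 (size s + n0.+1) ltac:(lia).
by exists T, n0.+1, j; split=> //; exact: cnt_prefix.
Qed.

Lemma smon_prudent H M C :
  BC_learns H M C -> strongly_monotone H M -> prudent H M C.
Proof.
move=> bc sm s i L Msi CL sL.
have [T [k [j [k0 Ts _ Mj <-]]]] := BC_eventually bc CL sL.
by apply: sm k0 _ Mj; rewrite Ts.
Qed.

(** In a chain, a conjecture not contained in [L] contains [L]. On a text for [L] extending [s] the
    learner would later have to drop it, although all data seen still lie in it. *)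
Lemma conservative_prudent H M C :
  (forall i, C (H i)) -> (forall L L', C L -> C L' -> L `<=` L' \/ L' `<=` L) ->
  BC_learns H M C -> conservative H M -> prudent H M C.
Proof.
move=> CH chain bc cons s i L Msi CL sL.
have [//|LH] := chain (H i) L (CH i) CL.
have [T [k [j [k0 Ts TL Mj Hj]]]] := BC_eventually bc CL sL.
have [eqH|ne] := pselect (H i = H j); first by rewrite eqH Hj.
case: (cons T (size s) k i j k0 _ Mj ne); first by rewrite Ts.
exact: subset_trans LH.
Qed.

(** The number [e] packs codes of a learner and of a hypothesis space. Matching the output with
    [i.+1] skips the answer ?, and stating all through [halts] makes sense of every [e], so
    enumerability is uniform in [e]. *)
Definition conjectured (S : nat -> Prop) (e x : nat) : Prop :=
  exists k, content_in S k /\ exists i, (exists n, halts (cfst e) k i.+1 n) /\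
  exists y, exists n, halts (csnd e) (cpair i x) y n.

Lemma conjecturedE (S : nat -> Prop) (H : nat -> set nat) (M : learner) cM cH x :
  (forall s, computes cM (encode_seq s) (encode_symbol (M s))) ->
  [set p | H (cfst p) (csnd p)] = [set p | exists y, computes cH p y] ->
  conjectured S (cpair (encode_code cM) (encode_code cH)) x <->
  exists s i, [/\ cnt s `<=` S, M s = Some i & H i x].
Proof.
move=> hM hH.
have EH i z : H i z <-> exists y, computes cH (cpair i z) y.
  by have := congr1 (fun A : set nat => A (cpair i z)) hH; rewrite /= cfstK csndK => ->.
rewrite /conjectured cfstK csndK; split.
  move=> [k [kS [i [/computesE hi [y /computesE hy]]]]].
  have [s es] := encode_seq_surj k; rewrite -es in kS hi.
  exists s, i; split; [exact/content_inE | | by apply/EH; exists y].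
  by have := computes_inj (hM s) hi; case: (M s) => //= ? [->].
move=> [s [i [sS Ms /EH[y hy]]]]; exists (encode_seq s); split; first exact/content_inE.
exists i; split; first by apply/computesE; have := hM s; rewrite Ms.
by exists y; apply/computesE.
Qed.

(** * Diagonalization against prudent learners *)

Section Main.
Variables (eta : nat -> nat -> Prop) (a : nat -> nat).
Hypotheses (eta_pos : positive_equivalence eta) (a_reps : least_reps eta a).

Let guess (e : nat) : nat -> Prop := conjectured (A_ eta a (slot e)) e.

Lemma re_guess : re (fun p => guess (cfst p) (csnd p)).
Proof.
rewrite /guess /conjectured /content_in /slot /symbol_at.
have rec_tail : recursive (fun k => csnd k.-1) by recursive_tac.
repeat first [ apply: re_or | apply: re_and | apply: re_computes | apply: re_ex
    | apply: re_all_lt | apply: re_eq | apply: (re_A eta_pos a_reps) ]; recursive_tac.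
Qed.

Lemma not_prudently_learnable (f : nat -> nat) H M :
  (forall e, (exists k, f k = slot e) <->
     reaches eta a (guess e) (slot e) \/
     ~ reaches eta a (cover_succ eta (guess e)) (slot e)) ->
  class_preserving H (range (A_ eta a \o f)) -> recursive_learner M ->
  BC_learns H M (range (A_ eta a \o f)) -> prudent H M (range (A_ eta a \o f)) ->
  False.
Proof.
move=> fP [[cH hH] rH] [cM hM] bc pr.
pose e := cpair (encode_code cM) (encode_code cH).
have guessE x : guess e x <->
    exists s i, [/\ cnt s `<=` A_ eta a (slot e), M s = Some i & H i x].
  exact: conjecturedE.
have [[er es et] _ _] := eta_pos.
have [inI|notI] := pselect (exists k, f k = slot e).
  have [k fk] := inI.
  have CA : range (A_ eta a \o f) (A_ eta a (slot e)) by exists k => //=; rewrite fk.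
  (* Prudence gives one inclusion; a correct conjecture on some text for [A (slot e)] gives the
     other. *)
  have guessA x : guess e x <-> A_ eta a (slot e) x.
    rewrite guessE; split=> [[s [i [sA Ms Hx]]]|Ax]; first exact: pr Ms CA sA x Hx.
    have nilA : cnt [::] `<=` A_ eta a (slot e) by [].
    have [T [m [j [_ _ TA Mj Hj]]]] := BC_eventually bc CA nilA.
    by exists (prefix_of T (size (@nil (option nat)) + m)), j; split=> //; rewrite Hj.
  case/fP: inI => [[x [xa /guessA]]|].
    by move/(A_rep eta_pos a_reps _ xa); rewrite ltnn.
  apply; exists (a (slot e)); split; first exact: er.
  (* The one extra class is that of [a (slot e)] itself: everything smaller is already guessed. *)
  exists (a (slot e)) => z; rewrite ltnS leq_eqVlt => /predU1P[->|lt].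
    by right; exact: er.
  by left; apply/guessA/(A_lt eta_pos a_reps).
apply: (notI); apply/fP.
have [h|noG] := pselect (reaches eta a (guess e) (slot e)); [by left | right].
move=> [x [xa [w hw]]]; set m := e + e + e.
(* Here [slot e] is m + 1. Each conjecture is some [A n] of the family, where n = slot e is vacant
   and n > slot e would make the guess reach the slot. So [a m] and [a m.+1] both remain unguessed,
   and the single class of [w] would have to contain both. *)
have guess_sub z : guess e z -> A_ eta a m z.
  move=> /guessE[s [i [sA Ms Hz]]].
  have [k _ /= Hi] : range (A_ eta a \o f) (H i) by rewrite -rH; exists i.
  have [lt|gt|eqc] := ltngtP (f k) (slot e).
  - by have /(A_sub eta_pos a_reps) : f k <= m by []; apply; rewrite Hi.
  - case: noG; exists (a (slot e)); split; first exact: er.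
    by apply/guessE; exists s, i; split=> //; rewrite -Hi; exact/(A_a eta_pos a_reps).
  - by case: notI; exists k.
have not_guess n : m <= n -> ~ guess e (a n).
  by move=> len /guess_sub/(A_a eta_pos a_reps); rewrite ltnNge len.
have le_x n : n <= slot e -> a n < x.+1.
  by move=> len; rewrite ltnS (leq_trans _ (a_least a_reps xa)) // (a_le a_reps).
have [/not_guess//|h1] := hw _ (le_x m (leqnSn m)); first by apply.
have [/not_guess|h2] := hw _ (le_x (slot e) (leqnn _)); first by apply; exact: leqnSn.
have := eta_a_inj eta_pos a_reps (et _ _ _ h1 (es _ _ h2)).
by rewrite /slot -/m; lia.
Qed.
End Main.

Theorem theorem17 (eta : nat -> nat -> Prop) (heta : positive_equivalence eta)
    (a : nat -> nat) (ha : least_reps eta a) :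
  exists C : set (set nat),
    [/\ eta_family eta C,
        C `<=` range (A_ eta a),
        ~ ConsvBC_learnable C &
        ~ SMonBC_learnable C].
Proof.
have [f [f_inj B_re fP]] := diagonal_family heta ha (re_guess heta ha).
have B_inj : injective (A_ eta a \o f).
  exact: inj_comp (A_inj heta ha) f_inj.
exists (range (A_ eta a \o f)); split.
- split.
  + rewrite (eq_finite_set (inj_card_eq (A := setT) (fun x y _ _ => @B_inj x y))).
    exact: infinite_nat.
  + by move=> _ [k _ <-]; exact: A_eta_closed.
  + by exists (A_ eta a \o f).
- by move=> _ [k _ <-]; exists (f k).
- move=> [H [M [HC M_rec bc cons]]].
  apply: (not_prudently_learnable heta ha fP HC M_rec bc).
  apply: conservative_prudent bc cons => [i|_ _ [k _ <-] [l _ <-]].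
    by case: HC => _ <-; exists i.
  by case: (leqP (f k) (f l)) => [|/ltnW] /(A_sub heta ha); [left | right].
- move=> [H [M [HC M_rec bc smon]]].
  exact: (not_prudently_learnable heta ha fP HC M_rec bc (smon_prudent bc smon)).
Qed.
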